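(* Let $(X,d)$ be any metric space, let $\bar y\in X$ and let $(s\in[0,1])\mapsto(\mathrm x(s),\bar y)$ be a variational c-segment on $(X\times X,d^2)$. Then for all $s\in[0,1]$, $$d^2(\mathrm x(s),\bar y)\le(1-s)d^2(\mathrm x(0),\bar y)+s\,d^2(\mathrm x(1),\bar y)-s(1-s)d^2(\mathrm x(0),\mathrm x(1)).$$
   Context: A variational c-segment on $(X\times X,d^2)$ is a pair $(\mathrm x,\bar y)$, with $\mathrm x\colon[0,1]\to X$ an arbitrary function (no continuity required) and $\bar y\in X$, such that for all $s\in(0,1)$ and all $y\in X$, $$d^2(\mathrm x(s),\bar y)-d^2(\mathrm x(s),y)\le (1-s)[d^2(\mathrm x(0),\bar y)-d^2(\mathrm x(0),y)]+s[d^2(\mathrm x(1),\bar y)-d^2(\mathrm x(1),y)].$$ *)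

(* Defs.v *)
From mathcomp Require Import all_boot all_order all_algebra.
From mathcomp Require Import mathcomp_extra interval_inference reals topology.

Set Implicit Arguments.
Unset Strict Implicit.
Unset Printing Implicit Defensive.

Import Order.TTheory GRing.Theory Num.Theory.

Local Open Scope ring_scope.

(* [{i01 R}] is the closed unit interval [0, 1] of R. *)
Definition variational_csegment_sqdist (R : realType) (X : metricType R)
    (x : {i01 R} -> X) (ybar : X) : Prop :=
  forall s : {i01 R}, 0 < s%:num < 1 -> forall y : X,
    mdist (x s) ybar ^+ 2 - mdist (x s) y ^+ 2 <=
      (1 - s%:num) * (mdist (x 0%:i01) ybar ^+ 2 - mdist (x 0%:i01) y ^+ 2)
      + s%:num * (mdist (x 1%:i01) ybar ^+ 2 - mdist (x 1%:i01) y ^+ 2).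

(* Main.v *)
Require Import Defs.
From mathcomp Require Import all_boot all_order all_algebra.
From mathcomp Require Import mathcomp_extra interval_inference reals topology.
From mathcomp Require Import lra ring.

Import Order.TTheory GRing.Theory Num.Theory.

Local Open Scope ring_scope.

(** At interior times, test the c-segment inequality with [y = x s]: the term
    [d^2(x s, y)] vanishes and what is subtracted on the right is
    [(1 - s) d^2(x 0, x s) + s d^2(x 1, x s)]. In any metric space this is at
    least [s (1 - s) d^2(x 0, x 1)] ([convex_sqdist_ge]), by the triangle
    inequality followed by a weighted quadratic inequality
    ([convex_sqr_ge_sqrD]). At the endpoints the claim is an equality. *)

(** The difference of the two sides is the square [((1 - t) a - t b)^2]. *)
Lemma convex_sqr_ge_sqrD (R : realDomainType) (t a b : R) :
  t * (1 - t) * (a + b) ^+ 2 <= (1 - t) * a ^+ 2 + t * b ^+ 2.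
Proof.
rewrite -subr_ge0.
have -> : (1 - t) * a ^+ 2 + t * b ^+ 2 - t * (1 - t) * (a + b) ^+ 2
          = ((1 - t) * a - t * b) ^+ 2 by ring.
exact: sqr_ge0.
Qed.

(** Bound [mdist p q] by passing through [z]. The constant is optimal: in a
    Euclidean space equality holds at [z = (1 - t) p + t q], which minimizes
    the right-hand side over [z]. *)
Lemma convex_sqdist_ge (R : realType) (X : metricType R) (t : R) (p q z : X) :
  0 <= t <= 1 ->
  t * (1 - t) * mdist p q ^+ 2
    <= (1 - t) * mdist p z ^+ 2 + t * mdist q z ^+ 2.
Proof.
move=> /andP[t0 t1]; apply: le_trans (convex_sqr_ge_sqrD _ _ _ _).
apply: ler_wpM2l; first by rewrite mulr_ge0 ?subr_ge0.
rewrite lerXn2r ?nnegrE ?addr_ge0 ?mdist_ge0 //.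
by rewrite (metric_sym q z) metric_triangle.
Qed.

Theorem lemma2p27 (R : realType) (X : metricType R) (ybar : X)
    (x : {i01 R} -> X) (hx : variational_csegment_sqdist x ybar)
    (s : {i01 R}) :
  mdist (x s) ybar ^+ 2 <=
    (1 - s%:num) * mdist (x 0%:i01) ybar ^+ 2
    + s%:num * mdist (x 1%:i01) ybar ^+ 2
    - s%:num * (1 - s%:num) * mdist (x 0%:i01) (x 1%:i01) ^+ 2.
Proof.
have s0 : 0 <= s%:num by [].
have s1 : s%:num <= 1 by [].
have [s_eq0|s_neq0] := eqVneq s%:num 0.
  have -> : s = 0%:i01 by apply: val_inj.
  by rewrite /= subr0 !mul0r mul1r addr0 subr0.
have [s_eq1|s_neq1] := eqVneq s%:num 1.
  have -> : s = 1%:i01 by apply: val_inj.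
  by rewrite /= subrr mulr0 !mul0r mul1r add0r subr0.
have s01 : 0 < s%:num < 1 by rewrite !lt_neqAle eq_sym s_neq0 s_neq1 s0 s1.
have := hx s s01 (x s); rewrite mdistxx.
set p := x 0%:i01; set q := x 1%:i01 => csegment_xs.
have := convex_sqdist_ge R X s%:num p q (x s).
rewrite s0 s1 => /(_ isT).
lra.
Qed.
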